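(* The function $$\Phi(x)=\frac{1}{\psi(x+1/2)-\ln x}-24x^2$$ is strictly increasing from $(0,\infty)$ onto $(0,21/5)$.
   Context: $\psi=\Gamma'/\Gamma$ is the psi (digamma) function. *)

(* Defs.v *)
From HB Require Import structures.
From mathcomp Require Import all_boot all_order all_algebra.
From mathcomp Require Import all_classical all_reals all_analysis.
Set Implicit Arguments.
Unset Strict Implicit.
Unset Printing Implicit Defensive.
Import Order.TTheory GRing.Theory Num.Theory.
Import numFieldNormedType.Exports.
Local Open Scope classical_set_scope.
Local Open Scope ring_scope.

(* Euler's integral, a convergent Lebesgue integral exactly when 0 < z; [Gamma]
   takes no meaningful value elsewhere. *)
Definition Gamma (R : realType) (z : R) : R :=
  \int[@lebesgue_measure R]_(t in `]0, +oo[) (t `^ (z - 1) * expR (- t)).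

Definition digamma (R : realType) (z : R) : R :=
  derive1 (@Gamma R) z / Gamma z.

Definition Phi (R : realType) (x : R) : R :=
  1 / (digamma (x + 1 / 2) - ln x) - 24 * x ^+ 2.

(* Main.v *)
(** Write [f x = psi (x + 1/2) - ln x]. The functional equation of [psi] gives
    [f x = f (x + 1) + gap x] with [gap] elementary, and the bounds
    [ln z - 1/z <= psi z <= ln z] give [f x -> 0] at infinity. So [f] is the
    limit of the iterates of [u |-> (fun x => u (x + 1) + gap x)] started at a
    rational function [excess_ub] with [1 / excess_ub x - 24 x^2] increasing.
    One iteration preserves both [u <= excess_ub] and the monotonicity of
    [1 / u x - 24 x^2], and even makes the latter strict. To see
    this on [x, y], compare [u (t + 1)] with [1 / (24 (t + 1)^2 + K)], where [K]
    makes them agree at [t = y]; for the latter the claim is an explicit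
    inequality between derivatives. *)

Require Import Defs.
From HB Require Import structures.
From mathcomp Require Import all_boot all_order all_algebra.
From mathcomp Require Import all_classical all_reals all_analysis.
From mathcomp Require Import measurable_realfun ring lra.
Set Implicit Arguments.
Unset Strict Implicit.
Import Order.TTheory GRing.Theory Num.Theory.
Import numFieldNormedType.Exports.
Local Open Scope classical_set_scope.
Local Open Scope ring_scope.

(** * The Gamma and digamma functions *)

Definition gamma_integrand (R : realType) (z t : R) : R :=
  t `^ (z - 1) * expR (- t).

Lemma gamma_integrand_ge0 (R : realType) (z t : R) : 0 <= gamma_integrand z t.
Proof. by rewrite mulr_ge0 ?powR_ge0 ?expR_ge0. Qed.

Lemma measurable_gamma_integrand (R : realType) (D : set R) (z : R) :
  measurable_fun D (gamma_integrand z).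
Proof.
apply: measurable_funTS; apply: measurable_funM; first exact: measurable_powR.
by apply: measurableT_comp => //; exact: measurable_expR.
Qed.

Lemma is_derive_powR_expRN (R : realType) (z t : R) : 0 < t ->
  is_derive t 1 (fun t => t `^ z * expR (- t))
    (z * gamma_integrand z t - gamma_integrand (z + 1) t).
Proof.
move=> t0; have ? := is_derive1_powR z t0.
apply: is_derive_eq; rewrite /gamma_integrand addrK /GRing.scale /=; ring.
Qed.

Lemma continuous_gamma_integrand (R : realType) (z t : R) : 0 < t ->
  {for t, continuous (gamma_integrand z)}.
Proof.
move=> t0; have [+ _] := is_derive_powR_expRN (z - 1) t0.
by move/derivable1_diffP/differentiable_continuous.
Qed.

(** The fundamental theorem of calculus applied to [t^z exp(-t)]. The identity is kept in the
    extended reals so that [a] and [b] can tend to the ends of the half-line before integrability is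
    known. *)
Lemma integral_gamma_integrand_parts (R : realType) (z a b : R) :
  0 < z -> 0 < a -> a < b ->
  (z%:E * \int[lebesgue_measure]_(t in `[a, b]) (gamma_integrand z t)%:E =
   \int[lebesgue_measure]_(t in `[a, b]) (gamma_integrand (z + 1) t)%:E +
   (b `^ z * expR (- b) - a `^ z * expR (- a))%:E)%E.
Proof.
move=> z0 a0 ab.
have pos t : t \in `[a, b] -> 0 < t.
  by rewrite in_itv/= => /andP[at_ _]; exact: lt_le_trans at_.
have cg w : {within `[a, b], continuous (gamma_integrand w)}.
  apply: continuous_in_subspaceT => t /[!inE]/= tab.
  exact/continuous_gamma_integrand/pos.
have ig w : lebesgue_measure.-integrable `[a, b] (EFin \o gamma_integrand w).
  by apply: continuous_compact_integrable => //; exact: segment_compact.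
have cF : {within `[a, b], continuous (fun t => t `^ z * expR (- t))}.
  apply: continuous_in_subspaceT => t /[!inE]/= tab.
  have [+ _] := is_derive_powR_expRN z (pos _ tab).
  by move/derivable1_diffP/differentiable_continuous.
have dF : derivable_oo_LRcontinuous (fun t => t `^ z * expR (- t)) a b.
  have /(continuous_within_itvP _ ab)[_ ? ?] := cF.
  by split=> // t /subset_itv_oo_cc/pos t0; have [] := is_derive_powR_expRN z t0.
have cf : {within `[a, b],
    continuous (fun t => z * gamma_integrand z t - gamma_integrand (z + 1) t)}.
  by move=> t; apply: cvgB; [apply: cvgZl_tmp|]; exact: cg.
have := continuous_FTC2 ab cf dF.
rewrite EFinB => <-; last first.
  move=> t /subset_itv_oo_cc/pos t0; rewrite derive1E.
  by have [_ ->] := is_derive_powR_expRN z t0.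
under [X in _ = (_ + X)%E]eq_integral do rewrite EFinB EFinM.
rewrite integralB //; [|exact: (integrableZl _ _ (ig z))|exact: ig].
rewrite integralZl//; last exact: ig.
rewrite [RHS]addeC subeK//.
exact: (integrable_fin_num _ (ig _)).
Qed.

(** With [n + 2] rather than [n + 1] the compact intervals are never degenerate, as integration by
    parts requires [a < b]. *)
Lemma bigcup_itv_pos (R : realType) :
  \bigcup_n `[n.+2%:R^-1, n.+2%:R]%classic = `]0, +oo[%classic :> set R.
Proof.
apply/seteqP; split => [x [n _]|x] /=; rewrite !in_itv/= ?andbT.
  by move=> /andP[+ _]; apply: lt_le_trans; rewrite invr_gt0.
move=> x0; exists (Num.truncn (x + x^-1)); rewrite //= in_itv/=.
have x0' : 0 < x^-1 by rewrite invr_gt0.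
have := truncnS_gt (x + x^-1); set n := Num.truncn _ => xn.
have n2 : n.+1%:R <= n.+2%:R :> R by rewrite ler_nat.
rewrite -[x in _ <= x]invrK lef_pV2 ?posrE//.
by apply/andP; split; lra.
Qed.

Lemma cvg_powR_expRN (R : realType) (z : R) :
  n.+2%:R `^ z * expR (- n.+2%:R) @[n --> \oo] --> (0 : R).
Proof.
pose m := (Num.truncn z).+1.
have zm : z <= m%:R by rewrite ltW// truncnS_gt.
apply: (@squeeze_cvgr _ _ _ _ (cst 0) (fun n => m.+1`!%:R * n.+1%:R^-1)).
- apply: nearW => n; rewrite mulr_ge0 ?powR_ge0 ?expR_ge0//=.
  have n0 : 0 < n.+2%:R :> R by [].
  (* The exponential dominates its Taylor term of degree [m + 1], one more than the bound [m] on
     [z], which leaves a factor of order [1/n]. *)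
  have h : n.+2%:R ^+ m.+1 / m.+1`!%:R <= expR n.+2%:R :> R.
    by apply: le_trans (expR_ge1Dxn m _) => //; rewrite lerDr.
  rewrite expRN ler_pdivrMr ?expR_gt0//.
  have h1 : n.+2%:R `^ z <= n.+2%:R ^+ m :> R.
    by rewrite -powR_mulrn// ler_powR// ler1n.
  apply: (le_trans h1).
  rewrite ler_pdivrMr ?ltr0n ?fact_gt0// in h.
  rewrite mulrAC ler_pdivlMr//.
  apply: (@le_trans _ _ (n.+2%:R ^+ m.+1)).
    by rewrite exprSr ler_wpM2l ?exprn_ge0// ler_nat.
  by rewrite mulrC.
- exact: cvg_cst.
- rewrite -[X in _ --> X](mulr0 (m.+1`!%:R)).
  by apply: cvgMl_tmp; exact: cvg_harmonic.
Qed.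

Lemma cvg_powR_expRN0 (R : realType) (z : R) : 0 < z ->
  n.+2%:R^-1 `^ z * expR (- n.+2%:R^-1) @[n --> \oo] --> (0 : R).
Proof.
move=> z0; have h0 : n.+2%:R^-1 @[n --> \oo] --> (0 : R).
  by have := @cvg_harmonic R; rewrite -(cvg_shiftS (@harmonic R)).
rewrite -[X in _ --> X](mul0r (expR (- 0))).
apply: cvgM; last first.
  apply: (@cvg_comp _ _ _ (fun n : nat => - n.+2%:R^-1 : R) expR _ (nbhs (- 0 : R))).
    exact: cvgN.
  exact: continuous_expR.
have /cvg_at_rightP := powR_cvg0 z0; apply; split=> // n.
Qed.

(** Monotone convergence along the compact exhaustion; the boundary terms vanish. Since both sides
    may a priori be infinite, the equation transfers finiteness from [z] to [z + 1] and back. *)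
Lemma integral_gamma_integrandS (R : realType) (z : R) : 0 < z ->
  (z%:E * \int[lebesgue_measure]_(t in `]0%R, +oo[) (gamma_integrand z t)%:E =
   \int[lebesgue_measure]_(t in `]0%R, +oo[) (gamma_integrand (z + 1) t)%:E)%E.
Proof.
move=> z0.
have cI w : (\int[lebesgue_measure]_(t in `[(n.+2%:R^-1)%R, (n.+2%:R : R)%R])
    (gamma_integrand w t)%:E @[n --> \oo] -->
    \int[lebesgue_measure]_(t in `]0%R, +oo[) (gamma_integrand w t)%:E)%E.
  rewrite -bigcup_itv_pos; apply: ge0_nondecreasing_set_cvg_integral => //.
  - move=> n m nm; rewrite subsetEset => x /=; rewrite !in_itv/= => /andP[xn xm].
    have nm' : n.+2%:R <= m.+2%:R :> R by rewrite ler_nat !ltnS.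
    rewrite (le_trans xm nm') andbT (le_trans _ xn)//.
    by rewrite lef_pV2 ?posrE.
  - by move=> n; apply/measurable_EFinP; exact: measurable_gamma_integrand.
  - by move=> n x _; rewrite lee_fin gamma_integrand_ge0.
have := cvgeZl (erefl : z%:E \is a fin_num) (cI z).
have lt2 n : (n.+2%:R^-1 : R) < n.+2%:R.
  by rewrite (@lt_le_trans _ _ 1)// ?invf_lt1 ?ltr1n ?ler1n.
under eq_fun do rewrite integral_gamma_integrand_parts ?invr_gt0//.
move=> /cvg_lim <- //.
apply/cvg_lim => //.
rewrite -[X in _ --> X]adde0; apply: cvgeD; [|exact: cI|].
  by rewrite fin_num_adde_defl.
apply: cvg_EFin; first exact: nearW.
rewrite -[X in _ --> X](subr0 (0 : R)).
by apply: cvgB; [exact: cvg_powR_expRN|exact: cvg_powR_expRN0].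
Qed.

Lemma ge0_integrable_lty d (T : measurableType d) (R : realType)
    (mu : {measure set T -> \bar R}) (D : set T) (f : T -> R) :
  measurable_fun D f -> (forall t, D t -> 0 <= f t) ->
  (\int[mu]_(t in D) (f t)%:E < +oo)%E -> mu.-integrable D (EFin \o f).
Proof.
move=> mf f0 foo; apply/integrableP; split; first exact/measurable_EFinP.
rewrite (eq_integral (EFin \o f))// => t /[!inE] Dt.
by rewrite gee0_abs// lee_fin f0.
Qed.

Lemma integrable_gamma_integrand1 (R : realType) :
  lebesgue_measure.-integrable `]0%R, +oo[ (EFin \o @gamma_integrand R 1).
Proof.
apply: ge0_integrable_lty.
- exact: measurable_gamma_integrand.
- by move=> t _; exact: gamma_integrand_ge0.
have -> : @gamma_integrand R 1 = fun t => expR (- t).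
  by apply/funext => t; rewrite /gamma_integrand subrr powRr0 mul1r.
rewrite integral_itv_obnd_cbnd; last first.
  apply/measurable_EFinP; apply: measurable_funTS.
  by apply: measurableT_comp => //; exact: measurable_expR.
have dF t : is_derive (t : R) 1 (fun s => - expR (- s)) (expR (- t)).
  by apply: is_derive_eq; rewrite /GRing.scale /=; ring.
have dE t : is_derive (t : R) 1 (fun s => expR (- s)) (- expR (- t)).
  by apply: is_derive_eq; rewrite /GRing.scale /=; ring.
have cE : continuous (fun t : R => expR (- t)).
  by move=> t; have [/derivable1_diffP/differentiable_continuous] := dE t.
rewrite (@ge0_continuous_FTC2y _ _ (fun t => - expR (- t)) 0 0) -?EFinB ?ltry//.
- exact: continuous_subspaceT.
- by rewrite -oppr0; apply: cvgN; exact: cvgr_expR.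
- by apply/cvg_at_right_filter; apply: cvgN; exact: cE.
- by move=> t _; rewrite derive1E; have [_ ->] := dF t.
Qed.

Lemma integrable_gamma_integrand_nat (R : realType) (n : nat) :
  lebesgue_measure.-integrable `]0%R, +oo[ (EFin \o @gamma_integrand R n.+1%:R).
Proof.
elim: n => [|n IH]; first exact: integrable_gamma_integrand1.
apply: ge0_integrable_lty.
- exact: measurable_gamma_integrand.
- by move=> t _; exact: gamma_integrand_ge0.
have /integrable_fin_num := IH => /(_ (measurable_itv _)) h.
by rewrite -addn1 natrD -integral_gamma_integrandS// ltey_eq fin_numM.
Qed.

Lemma powR_le_add (R : realType) (t u v w : R) : 0 < t -> u <= w <= v ->
  t `^ w <= t `^ u + t `^ v.
Proof.
move=> t0 /andP[uw wv]; have [t1|t1] := leP 1 t.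
  by rewrite (le_trans (ler_powR t1 wv))// lerDr powR_ge0.
have /ger_powR/(_ _ _ uw) : 0 < t <= 1 by rewrite t0 ltW.
by move/le_trans; apply; rewrite lerDl powR_ge0.
Qed.

(** The exponent [z + 1] lies between the integers 1 and [n + 2], whose integrands are integrable
    and dominate; the functional equation then descends to [z], since an infinite integral at [z]
    would make the one at [z + 1] infinite. *)
Lemma integrable_gamma_integrand (R : realType) (z : R) : 0 < z ->
  lebesgue_measure.-integrable `]0%R, +oo[ (EFin \o @gamma_integrand R z).
Proof.
move=> z0; pose n := Num.truncn z.
have iS : lebesgue_measure.-integrable `]0%R, +oo[
    (EFin \o @gamma_integrand R (z + 1)).
  have := integrableD _ (integrable_gamma_integrand1 R)
    (integrable_gamma_integrand_nat R n.+1).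
  move=> /(_ (measurable_itv _)); apply: le_integrable => //.
    by apply/measurable_EFinP; exact: measurable_gamma_integrand.
  move=> t /=; rewrite in_itv/= andbT => t0.
  rewrite lee_fin !ger0_norm ?addr_ge0 ?gamma_integrand_ge0//.
  rewrite /gamma_integrand -mulrDl ler_wpM2r ?expR_ge0// powR_le_add//.
  have := truncnS_gt z; rewrite -/n -[n.+2]addn1 natrD !addrK => /ltW ->.
  by rewrite subrr ltW.
apply: ge0_integrable_lty.
- exact: measurable_gamma_integrand.
- by move=> t _; exact: gamma_integrand_ge0.
have /integrable_fin_num := iS => /(_ (measurable_itv _)).
rewrite -integral_gamma_integrandS//.
rewrite ltey; apply: contraTN => /eqP ->.
by rewrite gt0_muley ?lte_fin.
Qed.

Lemma GammaS (R : realType) (z : R) : 0 < z -> Gamma (z + 1) = z * Gamma z.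
Proof.
move=> z0; rewrite /Gamma/Rintegral -integral_gamma_integrandS// fineM//.
by have /integrable_fin_num := integrable_gamma_integrand z0; exact.
Qed.

(** Passing to [z + 1] makes the exponent of [t] positive, so the integrand is at least [exp(-2)] on
    [[1, 2]]. *)
Lemma Gamma_gt0 (R : realType) (z : R) : 0 < z -> 0 < Gamma z.
Proof.
move=> z0; have z10 : 0 < z + 1 by rewrite addr_gt0.
rewrite -(pmulr_rgt0 _ z0) -GammaS//.
have /integrable_fin_num := integrable_gamma_integrand z10.
move=> /(_ (measurable_itv _)) ifin.
rewrite -lte_fin /Gamma /Rintegral fineK//.
apply: (@lt_le_trans _ _
  (\int[@lebesgue_measure R]_(t in `[1%R, 2%R]) (expR (- 2))%:E)%E).
  rewrite integral_cst//= lebesgue_measure_itv/= lte_fin ltr1n -EFinB.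
  by rewrite -EFinM lte_fin mulr_gt0 ?expR_gt0//; lra.
apply: (@le_trans _ _
  (\int[@lebesgue_measure R]_(t in `[1%R, 2%R]) (gamma_integrand (z + 1) t)%:E)%E).
  apply: ge0_le_integral => //.
  - by apply/measurable_EFinP; exact: measurable_gamma_integrand.
  move=> t /=; rewrite in_itv/= => /andP[t1 t2].
  rewrite lee_fin /gamma_integrand addrK -[leLHS]mul1r ler_pM ?expR_ge0//.
    by rewrite -(powRr0 t) ler_powR// ltW.
  by rewrite ler_expR lerN2.
apply: ge0_subset_integral => //.
- by apply/measurable_EFinP; exact: measurable_gamma_integrand.
- by move=> t _; rewrite lee_fin gamma_integrand_ge0.
move=> t /=; rewrite !in_itv/= => /andP[t1 _]; rewrite andbT.
by rewrite (lt_le_trans _ t1).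
Qed.

(** * Differentiating Gamma under the integral sign *)

Lemma is_derive_gamma_integrand (R : realType) (t z : R) : 0 < t ->
  is_derive z 1 (@gamma_integrand R ^~ t) (ln t * gamma_integrand z t).
Proof.
move=> t0.
have -> : @gamma_integrand R ^~ t = fun w : R => expR ((w - 1) * ln t) * expR (- t).
  by apply/funext => w; rewrite /gamma_integrand /powR gt_eqF.
apply: is_derive_eq; rewrite /gamma_integrand /powR gt_eqF// /GRing.scale /=; ring.
Qed.

Lemma normr_ln_le (R : realType) (t e : R) : 0 < t -> 0 < e ->
  `|ln t| <= t + e^-1 * t `^ (- e).
Proof.
move=> t0 e0; have te : 0 < t `^ (- e) by rewrite powR_gt0.
have te' : 0 < e^-1 * t `^ (- e) by rewrite mulr_gt0 ?invr_gt0.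
have [t1|t1] := leP 1 t.
  rewrite ger0_norm ?ln_ge0//; have := ln_sublinear t0; lra.
rewrite ler0_norm ?ln_le0 ?(ltW t1)//.
(* For [t < 1], the inequality [ln s < s] at [s = t^(-e)] reads [- e ln t < t^(-e)]. *)
have := ln_sublinear te; rewrite ln_powR => h.
have : - ln t < e^-1 * t `^ (- e).
  by rewrite mulrC ltr_pdivlMr//; lra.
by lra.
Qed.

Lemma powR_mul_gamma_integrand (R : realType) (t s z : R) : 0 < t ->
  t `^ s * gamma_integrand z t = gamma_integrand (z + s) t.
Proof.
move=> t0; rewrite /gamma_integrand mulrA -powRD; last first.
  by rewrite (gt_eqF t0) implybT.
by congr (_ `^ _ * _); ring.
Qed.

Lemma gamma_integrand_le (R : realType) (t u v w : R) : 0 < t -> u <= w <= v ->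
  gamma_integrand w t <= gamma_integrand u t + gamma_integrand v t.
Proof.
move=> t0 uwv; rewrite -mulrDl ler_wpM2r ?expR_ge0// powR_le_add//.
by rewrite !lerD2r.
Qed.

(* Dominates [ln t * gamma_integrand w t] for [z / 2 < w < 2 z], because
   [|ln t| <= t + t^(-z/4) / (z/4)]. *)
Definition gamma_majorant (R : realType) (z t : R) : R :=
  (gamma_integrand (z / 2 + 1) t + gamma_integrand (2 * z + 1) t) +
  (z / 4)^-1 * (gamma_integrand (z / 2 - z / 4) t + gamma_integrand (2 * z - z / 4) t).

Lemma gamma_majorant_ge0 (R : realType) (z t : R) : 0 < z -> 0 <= gamma_majorant z t.
Proof.
move=> z0; rewrite !addr_ge0 ?gamma_integrand_ge0// mulr_ge0//.
  by rewrite invr_ge0 divr_ge0 ?ltW.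
by rewrite !addr_ge0 ?gamma_integrand_ge0.
Qed.

Lemma integrable_gamma_majorant (R : realType) (z : R) : 0 < z ->
  lebesgue_measure.-integrable `]0%R, +oo[ (EFin \o gamma_majorant z).
Proof.
move=> z0.
have iD a b : 0 < a -> 0 < b -> lebesgue_measure.-integrable `]0%R, +oo[
    (EFin \o (fun t => @gamma_integrand R a t + gamma_integrand b t)).
  move=> a0 b0; have := integrableD _ (integrable_gamma_integrand a0)
    (integrable_gamma_integrand b0).
  by move=> /(_ (measurable_itv _)).
have [u1 v1 ue ve] :
    [/\ 0 < z / 2 + 1, 0 < 2 * z + 1, 0 < z / 2 - z / 4 & 0 < 2 * z - z / 4].
  by split; lra.
have := integrableD _ (iD _ _ u1 v1) (integrableZl _ (z / 4)^-1 (iD _ _ ue ve)).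
by move=> /(_ (measurable_itv _)); apply => //; exact: measurable_itv.
Qed.

Lemma normr_ln_gamma_integrand_le (R : realType) (z w t : R) : 0 < z ->
  z / 2 < w < 2 * z -> 0 < t -> `|ln t * gamma_integrand w t| <= gamma_majorant z t.
Proof.
move=> z0 /andP[uw wv] t0; rewrite normrM (ger0_norm (gamma_integrand_ge0 _ _)).
have e0 : 0 < z / 4 by lra.
apply: (@le_trans _ _ ((t `^ 1 + (z / 4)^-1 * t `^ (- (z / 4))) *
    (gamma_integrand (z / 2) t + gamma_integrand (2 * z) t))).
  rewrite ler_pM ?gamma_integrand_ge0//.
    by rewrite powRr1; [exact: normr_ln_le|exact: ltW].
  by apply: gamma_integrand_le => //; rewrite !ltW.
rewrite mulrDl -mulrA !mulrDr !powR_mul_gamma_integrand// /gamma_majorant mulrDr.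
exact: lexx.
Qed.

Lemma integrable_ln_gamma_integrand (R : realType) (z : R) : 0 < z ->
  lebesgue_measure.-integrable `]0%R, +oo[
    (EFin \o (fun t => ln t * gamma_integrand z t)).
Proof.
move=> z0; apply: le_integrable (integrable_gamma_majorant z0) => //.
  apply/measurable_EFinP; apply: measurable_funM.
    by apply: measurable_funTS; exact: measurable_ln.
  exact: measurable_gamma_integrand.
move=> t /=; rewrite in_itv/= andbT => t0.
rewrite lee_fin [leRHS]ger0_norm ?gamma_majorant_ge0//.
by apply: normr_ln_gamma_integrand_le => //; apply/andP; split; lra.
Qed.

Lemma is_derive_Gamma (R : realType) (z : R) : 0 < z -> is_derive z 1 (@Gamma R)
  (\int[@lebesgue_measure R]_(t in `]0%R, +oo[) (ln t * gamma_integrand z t)).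
Proof.
move=> z0.
have d1E w t : 0 < t ->
    partial1of2 (@gamma_integrand R) w t = ln t * gamma_integrand w t.
  by move=> t0; rewrite partial1of2E; have [_ ->] := is_derive_gamma_integrand w t0.
have zI : `]z / 2, 2 * z[%classic z.
  by rewrite /= in_itv/=; apply/andP; split; lra.
have iI w : `]z / 2, 2 * z[%classic w ->
    lebesgue_measure.-integrable `]0%R, +oo[ (EFin \o @gamma_integrand R w).
  rewrite /= in_itv/= => /andP[zw _]; apply: integrable_gamma_integrand.
  by apply: le_lt_trans zw; rewrite divr_ge0 ?ltW.
have dI w t : `]z / 2, 2 * z[%classic w -> `]0%R, +oo[%classic t ->
    derivable (@gamma_integrand R ^~ t) w 1.
  move=> _; rewrite /= in_itv/= andbT => t0.
  by have [] := is_derive_gamma_integrand w t0.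
have bI w t : `]z / 2, 2 * z[%classic w -> `]0%R, +oo[%classic t ->
    `|partial1of2 (@gamma_integrand R) w t| <= gamma_majorant z t.
  rewrite /= !in_itv/= andbT => zw t0; rewrite d1E//.
  exact: normr_ln_gamma_integrand_le.
have G0 t := gamma_majorant_ge0 t z0.
have iG := integrable_gamma_majorant z0.
have -> : @Gamma R = fun w =>
    \int[@lebesgue_measure R]_(t in `]0%R, +oo[) gamma_integrand w t by [].
split.
  exact: (@derivable_under_integral _ _ _ (@lebesgue_measure R) _ _
    (measurable_itv _) _ _ _
    zI iI dI _ G0 iG bI).
rewrite -derive1E (@differentiation_under_integral _ _ _ (@lebesgue_measure R) _ _
    (measurable_itv _)
  _ _ _ zI iI dI _ G0 iG bI).
by apply: eq_Rintegral => t; rewrite inE/= in_itv/= andbT; exact: d1E.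
Qed.

Lemma digammaE (R : realType) (z : R) : 0 < z -> digamma z * Gamma z =
  \int[@lebesgue_measure R]_(t in `]0%R, +oo[) (ln t * gamma_integrand z t).
Proof.
move=> z0; rewrite /digamma divfK ?gt_eqF ?Gamma_gt0// derive1E.
by have [_ ->] := is_derive_Gamma z0.
Qed.

Lemma digammaS (R : realType) (z : R) : 0 < z ->
  digamma (z + 1) = digamma z + z^-1.
Proof.
move=> z0; have z10 : 0 < z + 1 by rewrite addr_gt0.
have Gz := Gamma_gt0 z0; have Gz1 := Gamma_gt0 z10.
have dz : is_derive z 1 (@Gamma R) (derive1 (@Gamma R) z).
  by rewrite derive1E; apply: derivableP; have [] := is_derive_Gamma z0.
have dz1 : is_derive (z + 1) 1 (@Gamma R) (derive1 (@Gamma R) (z + 1)).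
  by rewrite derive1E; apply: derivableP; have [] := is_derive_Gamma z10.
have d1 : is_derive z 1 (fun w => Gamma (w + 1)) (derive1 (@Gamma R) (z + 1)).
  have ds : is_derive z 1 (fun w : R => w + 1) 1.
    by apply: is_derive_eq; rewrite addr0.
  by have := @is_derive1_comp _ _ (fun w : R => w + 1) z _ _ dz1 ds; rewrite mulr1.
have d2 : is_derive z 1 (fun w => w * @Gamma R w)
    (Gamma z + z * derive1 (@Gamma R) z).
  by apply: is_derive_eq; rewrite /GRing.scale /= mulr1 addrC.
have E : derive1 (@Gamma R) (z + 1) = Gamma z + z * derive1 (@Gamma R) z.
  have [_ <-] := d1; have [_ <-] := d2.
  apply: near_eq_derive.
  near=> w; apply: GammaS; near: w; exact: lt_nbhsr.
rewrite /digamma E GammaS//; field; by rewrite !gt_eqF.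
Unshelve. all: end_near. Qed.

(** Jensen's inequality: the tangent bound [ln t <= ln z + t/z - 1] is integrated against the Gamma
    density of parameter [z], whose mean is [z]. *)
Lemma digamma_le_ln (R : realType) (z : R) : 0 < z -> digamma z <= ln z.
Proof.
move=> z0; have Gz := Gamma_gt0 z0.
rewrite -(ler_pM2r Gz) digammaE//.
have iz := integrable_gamma_integrand z0.
have z10 : 0 < z + 1 by rewrite addr_gt0.
have iz1 := integrable_gamma_integrand z10.
apply: (@le_trans _ _ (\int[@lebesgue_measure R]_(t in `]0%R, +oo[)
    ((ln z - 1) * gamma_integrand z t + z^-1 * gamma_integrand (z + 1) t))).
  apply: le_Rintegral => //.
  - exact: integrable_ln_gamma_integrand.
  - apply: (integrableD _ (integrableZl _ _ iz) (integrableZl _ _ iz1)) => //.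
  move=> t /=; rewrite in_itv/= andbT => t0.
  rewrite -[gamma_integrand (z + 1) t]powR_mul_gamma_integrand// powRr1; last exact: ltW.
  rewrite [z^-1 * _]mulrA -mulrDl.
  rewrite ler_wpM2r ?gamma_integrand_ge0//.
  have tz : 0 < t / z by rewrite divr_gt0.
  have := @le_ln1Dx R (t / z - 1); rewrite addrCA subrr addr0 ln_div ?posrE//.
  by move=> h; have {}h := h ltac:(lra); lra.
rewrite RintegralD//; [|exact: (integrableZl _ _ iz)|exact: (integrableZl _ _ iz1)].
rewrite !RintegralZl// -!/(Gamma _) GammaS// mulKf ?gt_eqF//.
lra.
Qed.

(** The dual bound [ln t >= ln z + 1 - z/t] is integrated against the Gamma density of parameter
    [z + 1], under which [1/t] has mean [1/z]. *)
Lemma ln_le_digammaS (R : realType) (z : R) : 0 < z -> ln z <= digamma (z + 1).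
Proof.
move=> z0; have z10 : 0 < z + 1 by rewrite addr_gt0.
have Gz := Gamma_gt0 z0; have Gz1 := Gamma_gt0 z10.
rewrite -(ler_pM2r Gz1) digammaE//.
have iz := integrable_gamma_integrand z0.
have iz1 := integrable_gamma_integrand z10.
apply: (@le_trans _ _ (\int[@lebesgue_measure R]_(t in `]0%R, +oo[)
    ((ln z + 1) * gamma_integrand (z + 1) t - z * gamma_integrand z t))).
  rewrite RintegralB//; [|exact: (integrableZl _ _ iz1)|exact: (integrableZl _ _ iz)].
  rewrite !RintegralZl// -!/(Gamma _) GammaS//; lra.
apply: le_Rintegral => //.
- apply: (integrableB _ (integrableZl _ _ iz1) (integrableZl _ _ iz)) => //.
- exact: integrable_ln_gamma_integrand.
move=> t /=; rewrite in_itv/= andbT => t0.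
rewrite -[gamma_integrand (z + 1) t]powR_mul_gamma_integrand// powRr1; last exact: ltW.
rewrite [(ln z + 1) * _]mulrA [ln t * _]mulrA -mulrBl.
rewrite ler_wpM2r ?gamma_integrand_ge0//.
have tz : 0 < z / t by rewrite divr_gt0.
have := @le_ln1Dx R (z / t - 1); rewrite addrCA subrr addr0 ln_div ?posrE//.
move=> h; have {}h := h ltac:(lra).
have := ler_wpM2l (ltW t0) h; rewrite mulrBr mulrBr mulrCA divff ?gt_eqF// !mulr1.
lra.
Qed.

(** * The increment of psi(x + 1/2) - ln x *)

Ltac pos :=
  lazymatch goal with
  | |- is_true (0 < _ * _) => apply: mulr_gt0; pos
  | |- is_true (0 < _ ^+ _) => apply: exprn_gt0; pos
  | |- is_true (0 < _^-1) => rewrite invr_gt0; pos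
  | |- _ => lra
  end.

Ltac neq0 := repeat (apply/andP; split); apply: lt0r_neq0; pos.

(* With [y = 1 / (2 x + 1)], [gap x = ln (1 + y) - ln (1 - y) - 2 y], and this is
   [2/3 y^3 (1 - 2/5 y^2) / (1 - y^2)]. *)
Definition gap_ub (R : realType) (x : R) : R :=
  (20 * x * (x + 1) + 3) / (30 * x * (x + 1) * (2 * x + 1) ^+ 3).

(* [1 / excess_ub x = 24 x^2 + 21 x^2 / (5 x^2 + 2)]: the correction tends to
   [21/5], approaches it more slowly than [Phi], and vanishes at [0] so that
   [excess_ub] can dominate the logarithmic singularity there. *)
Definition excess_ub (R : realType) (x : R) : R :=
  (5 * x ^+ 2 + 2) / (3 * x ^+ 2 * (40 * x ^+ 2 + 23)).

(** Makes [excess_ub] a supersolution of the recurrence, so that iterating stays below it. Over a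
    common denominator the numerator has positive coefficients only. *)
Lemma gap_ub_le_excess_ub_sub (R : realType) (x : R) : 0 < x ->
  gap_ub x <= excess_ub x - excess_ub (x + 1).
Proof.
move=> x0.
have [x20 x10] : 0 < 40 * x ^+ 2 + 23 /\ 0 < 40 * (x + 1) ^+ 2 + 23.
  by split; nra.
have y0 : 0 < x + 1 by lra.
have w0 : 0 < 2 * x + 1 by lra.
have [x2 x3 x4 x5] : [/\ 0 < x ^+ 2, 0 < x ^+ 3, 0 < x ^+ 4 & 0 < x ^+ 5].
  by rewrite !exprn_gt0.
rewrite -subr_ge0.
have -> : excess_ub x - excess_ub (x + 1) - gap_ub x =
  (460 * x ^+ 4 + 920 * x ^+ 3 + 7793 * x ^+ 2 + 7333 * x + 1260) /
  (30 * x ^+ 2 * (x + 1) ^+ 2 * (2 * x + 1) ^+ 3 * (40 * x ^+ 2 + 23) *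
   (40 * (x + 1) ^+ 2 + 23)).
  rewrite /excess_ub /gap_ub; field.
  by neq0.
by apply: ltW; pos.
Qed.

(** Places the vertex [g = x * gap_ub x] of the quadratic [- 48 g^2 + 96 x (gap_ub x) g] at or
    beyond [excess_ub (x + 1)], so that this quadratic increases in [g] up to there. *)
Lemma excess_ub_le_mul_gap_ub (R : realType) (x : R) : 0 < x ->
  excess_ub (x + 1) <= x * gap_ub x.
Proof.
move=> x0.
have y0 : 0 < x + 1 by lra.
have x10 : 0 < 40 * (x + 1) ^+ 2 + 23 by nra.
have w0 : 0 < 2 * x + 1 by lra.
rewrite -subr_ge0.
have -> : x * gap_ub x - excess_ub (x + 1) =
  ((20 * x * (x + 1) + 3) * (x + 1) * (40 * (x + 1) ^+ 2 + 23) -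
   10 * (2 * x + 1) ^+ 3 * (5 * (x + 1) ^+ 2 + 2)) /
  (30 * (x + 1) ^+ 2 * (2 * x + 1) ^+ 3 * (40 * (x + 1) ^+ 2 + 23)).
  rewrite /excess_ub /gap_ub; field.
  by neq0.
apply: ltW; apply: divr_gt0; last by pos.
have [x2 x3 x4 x5] : [/\ 0 < x ^+ 2, 0 < x ^+ 3, 0 < x ^+ 4 & 0 < x ^+ 5].
  by rewrite !exprn_gt0.
nra.
Qed.

(** The extreme case of [gap_step_lt], with [excess_ub (x + 1)] for [g] and [gap_ub x] for [gap x].
    The right-hand side is minus the derivative of [gap]. *)
Lemma excess_ub_step_margin (R : realType) (x : R) : 0 < x ->
  - 48 * excess_ub (x + 1) ^+ 2 + 96 * x * gap_ub x * excess_ub (x + 1) +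
    48 * x * gap_ub x ^+ 2 < 1 / (x * (x + 1) * (2 * x + 1) ^+ 2).
Proof.
move=> x0.
have y0 : 0 < x + 1 by lra.
have x10 : 0 < 40 * (x + 1) ^+ 2 + 23 by nra.
have w0 : 0 < 2 * x + 1 by lra.
rewrite -subr_gt0.
set lhs := (X in 0 < X).
pose A := 5 * (x + 1) ^+ 2 + 2; pose C := 40 * (x + 1) ^+ 2 + 23.
pose N := 20 * x * (x + 1) + 3; pose w := 2 * x + 1.
have -> : lhs = (75 * w ^+ 4 * (x + 1) ^+ 3 * C ^+ 2 + 400 * A ^+ 2 * x * w ^+ 6
   - 80 * x * N * A * (x + 1) * w ^+ 3 * C - 4 * N ^+ 2 * (x + 1) ^+ 2 * C ^+ 2) /
  (75 * x * (x + 1) ^+ 4 * w ^+ 6 * C ^+ 2).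
  rewrite /lhs /excess_ub /gap_ub /A /C /N /w; field.
  by neq0.
rewrite {}/A {}/C {}/N {}/w {lhs}.
apply: divr_gt0; last by pos.
(* The numerator expands into powers of [x] with nonnegative coefficients, so positivity of these
   powers suffices. *)
have X n : 0 < x ^+ n by exact: exprn_gt0.
have X2 := X 2; have X3 := X 3; have X4 := X 4; have X5 := X 5; have X6 := X 6.
have X7 := X 7; have X8 := X 8; have X9 := X 9; have X10 := X 10.
have X11 := X 11; have X12 := X 12; have X13 := X 13.
clear X; lra.
Qed.

(** * Elementary bounds for the logarithmic increment *)

Lemma derive_gt0_lt (R : realType) (f df : R -> R) (a b : R) : a < b ->
  (forall t, a <= t <= b -> is_derive t 1 f (df t)) ->
  (forall t, a < t < b -> 0 < df t) -> f a < f b.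
Proof.
move=> ab dfE df0.
have cf : {within `[a, b], continuous f}.
  apply: continuous_in_subspaceT => t /[!inE]/=; rewrite in_itv/= => /dfE[+ _].
  by move/derivable1_diffP/differentiable_continuous.
have dfE' t : t \in `]a, b[ -> is_derive t 1 f (df t).
  by rewrite in_itv/= => /andP[at_ tb]; apply: dfE; rewrite !ltW.
have [c] := MVT ab dfE' cf.
rewrite in_itv/= => /df0 dfc fE; rewrite -subr_gt0 fE.
by rewrite mulr_gt0// subr_gt0.
Qed.

Lemma is_derive_ln_ratio (R : realType) (t : R) : -1 < t < 1 ->
  is_derive t 1 (fun y => ln (1 + y) - ln (1 - y)) (2 / (1 - t ^+ 2)).
Proof.
move=> /andP[t1 t2].
have p0 : 0 < 1 + t by lra.
have m0 : 0 < 1 - t by lra.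
have dp : is_derive t 1 (fun y => 1 + y) (1 : R).
  by apply: is_derive_eq; rewrite /GRing.scale /=; ring.
have dm : is_derive t 1 (fun y => 1 - y) (- 1 : R).
  by apply: is_derive_eq; rewrite /GRing.scale /=; ring.
have := is_deriveB
  (@is_derive1_comp _ _ (fun y => 1 + y) t _ _ (is_derive1_ln p0) dp)
  (@is_derive1_comp _ _ (fun y => 1 - y) t _ _ (is_derive1_ln m0) dm).
move=> H; apply: (is_derive_eq H); field.
by rewrite (gt_eqF p0) (gt_eqF m0) andbT gt_eqF//; nra.
Qed.

(** A partial sum of the power series; the derivative of the remainder is the geometric tail
    [2 t^6 / (1 - t^2)]. *)
Lemma ln_ratio_gt (R : realType) (y : R) : 0 < y < 1 ->
  2 * y + 2 / 3 * y ^+ 3 + 2 / 5 * y ^+ 5 < ln (1 + y) - ln (1 - y).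
Proof.
move=> /andP[y0 y1].
pose f (t : R) := (ln (1 + t) - ln (1 - t)) - (2 * t + 2 / 3 * t ^+ 3 + 2 / 5 * t ^+ 5).
suff : f 0 < f y.
  rewrite /f !addr0 !subr0 ln1 !expr0n /=; lra.
apply: (derive_gt0_lt (df := fun t => 2 * t ^+ 6 / (1 - t ^+ 2)) y0) => t /andP[t0 t1].
  have t2 : -1 < t < 1 by apply/andP; split; lra.
  have d1 := is_derive_ln_ratio t2.
  apply: is_derive_eq; rewrite /GRing.scale /=; field.
  by rewrite gt_eqF//; nra.
by rewrite divr_gt0 ?mulr_gt0 ?exprn_gt0//; nra.
Qed.

(** The right-hand side is the power series with every coefficient [2/7, 2/9, ...] after that of
    [y^5] raised to [2/5], summed as a geometric series. *)
Lemma ln_ratio_lt (R : realType) (y : R) : 0 < y < 1 ->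
  ln (1 + y) - ln (1 - y) <
  2 * y + 2 / 3 * (y ^+ 3 - 2 / 5 * y ^+ 5) / (1 - y ^+ 2).
Proof.
move=> /andP[y0 y1].
pose f (t : R) := 2 * t + 2 / 3 * (t ^+ 3 - 2 / 5 * t ^+ 5) / (1 - t ^+ 2) -
  (ln (1 + t) - ln (1 - t)).
suff : f 0 < f y.
  rewrite /f !addr0 !subr0 ln1 !expr0n /=; lra.
apply: (derive_gt0_lt (df := fun t => 4 / 5 * t ^+ 6 / (1 - t ^+ 2) ^+ 2) y0)
  => t /andP[t0 t1].
  have t2 : -1 < t < 1 by apply/andP; split; lra.
  have d1 := is_derive_ln_ratio t2.
  have n0 : 1 - t ^+ 2 != 0 by rewrite gt_eqF//; nra.
  have d2 := @is_deriveV _ (fun t => 1 - t ^+ 2) t _ 1 n0 _.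
  apply: is_derive_eq; rewrite /GRing.scale /=; field.
  done.
by rewrite !mulr_gt0 ?invr_gt0 ?exprn_gt0//; nra.
Qed.

Definition gap (R : realType) (x : R) : R := ln (x + 1) - ln x - 1 / (x + 1 / 2).

Lemma gapE (R : realType) (x : R) : 0 < x -> gap x =
  ln (1 + 1 / (2 * x + 1)) - ln (1 - 1 / (2 * x + 1)) - 2 * (1 / (2 * x + 1)).
Proof.
move=> x0; have w0 : 0 < 2 * x + 1 by lra.
have -> : 1 + 1 / (2 * x + 1) = (x + 1) * (2 / (2 * x + 1)).
  by field; rewrite (gt_eqF w0).
have -> : 1 - 1 / (2 * x + 1) = x * (2 / (2 * x + 1)).
  by field; rewrite (gt_eqF w0).
have v0 : 0 < 2 / (2 * x + 1) by rewrite divr_gt0.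
have y0 : 0 < x + 1 by lra.
move: (2 / _) v0 => c v0; rewrite /gap !lnM ?posrE//.
have -> : 1 / (x + 1 / 2) = 2 * (1 / (2 * x + 1)).
  by field; neq0.
lra.
Qed.

Lemma gap_y_lt1 (R : realType) (x : R) : 0 < x -> 0 < 1 / (2 * x + 1) < 1.
Proof.
move=> x0; have w0 : 0 < 2 * x + 1 by lra.
by rewrite divr_gt0//= ltr_pdivrMr//; lra.
Qed.

Lemma gap_lt_ub (R : realType) (x : R) : 0 < x -> gap x < gap_ub x.
Proof.
move=> x0; have w0 : 0 < 2 * x + 1 by lra.
have := ln_ratio_lt (gap_y_lt1 x0); rewrite gapE//.
suff -> : gap_ub x = 2 / 3 * ((1 / (2 * x + 1)) ^+ 3 - 2 / 5 * (1 / (2 * x + 1)) ^+ 5) /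
    (1 - (1 / (2 * x + 1)) ^+ 2) by lra.
rewrite /gap_ub; field.
have y0 : 0 < x + 1 by lra.
rewrite (gt_eqF w0) (gt_eqF x0) (gt_eqF y0) /= gt_eqF//; nra.
Qed.

(** The function for which the expression defining [Phi] would be constantly [21/5]. *)
Definition excess_lb (R : realType) (x : R) : R := 1 / (24 * x ^+ 2 + 21 / 5).

Lemma excess_lb_sub_le_gap (R : realType) (x : R) : 0 < x ->
  excess_lb x - excess_lb (x + 1) <= gap x.
Proof.
move=> x0; have w0 : 0 < 2 * x + 1 by lra.
have := ln_ratio_gt (gap_y_lt1 x0); rewrite gapE//.
suff : excess_lb x - excess_lb (x + 1) <=
  2 / 3 * (1 / (2 * x + 1)) ^+ 3 + 2 / 5 * (1 / (2 * x + 1)) ^+ 5 by lra.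
have [x20 x10] : 0 < 24 * x ^+ 2 + 21 / 5 /\ 0 < 24 * (x + 1) ^+ 2 + 21 / 5.
  by split; nra.
rewrite -subr_ge0 /excess_lb; set e := (X in 0 <= X).
(* In powers of [w = 2 x + 1] the numerator loses its [w^6] term thanks to the constant 24 and its
   [w^4] term thanks to [21/5]; what remains is positive. *)
have -> : e = (2 / 15 * (5 * (2 * x + 1) ^+ 2 + 3) * (24 * x ^+ 2 + 21 / 5) *
   (24 * (x + 1) ^+ 2 + 21 / 5) - 24 * (2 * x + 1) ^+ 6) /
  ((2 * x + 1) ^+ 5 * (24 * x ^+ 2 + 21 / 5) * (24 * (x + 1) ^+ 2 + 21 / 5)).
  rewrite /e; field; rewrite (gt_eqF w0) /=.
  apply/andP; split; rewrite gt_eqF//; nra.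
apply: ltW; apply: divr_gt0; last by pos.
have [x2 x3 x4 x5] : [/\ 0 < x ^+ 2, 0 < x ^+ 3, 0 < x ^+ 4 & 0 < x ^+ 5].
  by rewrite !exprn_gt0.
have x6 : 0 < x ^+ 6 by rewrite exprn_gt0.
lra.
Qed.

Lemma gap_gt0 (R : realType) (x : R) : 0 < x -> 0 < gap x.
Proof.
move=> x0; have /andP[y0 y1] := gap_y_lt1 x0.
have := ln_ratio_gt (gap_y_lt1 x0); rewrite gapE//.
have := exprn_gt0 3 y0; have := exprn_gt0 5 y0; lra.
Qed.

Lemma is_derive_gap (R : realType) (x : R) : 0 < x ->
  is_derive x 1 (@gap R) (- (1 / (x * (x + 1) * (2 * x + 1) ^+ 2))).
Proof.
move=> x0; have y0 : 0 < x + 1 by lra.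
have d1 : is_derive x 1 (fun t => t + 1) (1 : R).
  by apply: is_derive_eq; rewrite /GRing.scale /=; ring.
have d2 : is_derive x 1 (fun t => t + 1 / 2) (1 : R).
  by apply: is_derive_eq; rewrite /GRing.scale /=; ring.
have n0 : x + 1 / 2 != 0 by rewrite gt_eqF//; lra.
have d3 := @is_deriveV _ (fun t => t + 1 / 2) x _ 1 n0 d2.
have d4 := @is_derive1_comp _ _ (fun t => t + 1) x _ _ (is_derive1_ln y0) d1.
have -> : @gap R = fun t => (@ln R \o (fun t => t + 1)) t - ln t - (t + 1 / 2)^-1.
  by apply/funext => t; rewrite /gap div1r.
have d5 := is_derive1_ln x0.
apply: is_derive_eq; rewrite /GRing.scale /=; field.
by neq0.
Qed.

(** * The iteration step *)

Definition Phi_lb (R : realType) (x : R) : R := 21 * x ^+ 2 / (5 * x ^+ 2 + 2).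

Lemma excess_ub_gt0 (R : realType) (x : R) : 0 < x -> 0 < excess_ub x.
Proof.
move=> x0; have x2 : 0 < x ^+ 2 by rewrite exprn_gt0.
by rewrite /excess_ub; pos.
Qed.

Lemma excess_ubE (R : realType) (x : R) : 0 < x ->
  1 / excess_ub x = 24 * x ^+ 2 + Phi_lb x.
Proof.
move=> x0; have x2 : 0 < x ^+ 2 by rewrite exprn_gt0.
rewrite /excess_ub /Phi_lb; field.
by neq0.
Qed.

Lemma Phi_lb_gt0 (R : realType) (x : R) : 0 < x -> 0 < Phi_lb x.
Proof.
move=> x0; have x2 : 0 < x ^+ 2 by rewrite exprn_gt0.
by rewrite /Phi_lb; pos.
Qed.

Lemma Phi_lb_le (R : realType) (x y : R) : 0 < x -> x <= y -> Phi_lb x <= Phi_lb y.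
Proof.
move=> x0 xy; have x2 : 0 < x ^+ 2 by rewrite exprn_gt0.
have xy2 : x ^+ 2 <= y ^+ 2 by rewrite ler_sqr ?nnegrE//; lra.
have x3 : 0 < 5 * x ^+ 2 + 2 by lra.
have y3 : 0 < 5 * y ^+ 2 + 2 by lra.
rewrite -subr_ge0; have -> : Phi_lb y - Phi_lb x =
  42 * (y ^+ 2 - x ^+ 2) / ((5 * x ^+ 2 + 2) * (5 * y ^+ 2 + 2)).
  by rewrite /Phi_lb; field; neq0.
by rewrite divr_ge0 ?mulr_ge0 ?subr_ge0// ltW.
Qed.

(** For [g = 1/q] with [q' = 48 (x + 1)], this says that [1 / (g + gap x) - 24 x^2] has positive
    derivative, after multiplication by [(g + gap x)^2]. *)
Lemma gap_step_lt (R : realType) (x g : R) : 0 < x -> 0 < g -> g <= excess_ub (x + 1) ->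
  48 * x * (g + gap x) ^+ 2 <
  48 * (x + 1) * g ^+ 2 + 1 / (x * (x + 1) * (2 * x + 1) ^+ 2).
Proof.
move=> x0 g0 gU; have := excess_ub_step_margin x0; have := excess_ub_le_mul_gap_ub x0.
have := gap_lt_ub x0; have := gap_gt0 x0.
move: (gap x) (gap_ub x) (excess_ub (x + 1)) (1 / _) gU => d D U r gU d0 dD UD h.
(* The bound increases in [gap x] and, as [g <= U <= x * D], also in [g]. *)
have h1 : 0 <= (U - g) * (2 * (x * D) - U - g).
  by rewrite mulr_ge0 //; lra.
have h2 : 0 <= x * (D - d) * (D + d + 2 * g).
  by rewrite !mulr_ge0//; lra.
lra.
Qed.

Lemma gap_step (R : realType) (x y a b : R) : 0 < x -> x < y ->
  0 < a -> 0 < b -> b <= excess_ub (y + 1) ->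
  24 * ((y + 1) ^+ 2 - (x + 1) ^+ 2) <= 1 / b - 1 / a ->
  24 * (y ^+ 2 - x ^+ 2) < 1 / (b + gap y) - 1 / (a + gap x).
Proof.
move=> x0 xy a0 b0 bU ab.
(* [(q t)^-1] is [b] at [t = y] and at most [a] at [t = x]. *)
pose K := 1 / b - 24 * (y + 1) ^+ 2.
pose q (t : R) := 24 * (t + 1) ^+ 2 + K.
pose h (t : R) := (q t)^-1 + gap t.
pose f (t : R) := (h t)^-1 - 24 * t ^+ 2.
have y10 : 0 < y + 1 by lra.
have K_lb : Phi_lb (y + 1) <= K.
  have : 1 / excess_ub (y + 1) <= 1 / b by rewrite !div1r lef_pV2 ?posrE// excess_ub_gt0.
  rewrite excess_ubE// /K; lra.
have K0 : 0 < K by apply: lt_le_trans K_lb; exact: Phi_lb_gt0.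
have q0 t : 0 < q t by have := sqr_ge0 (t + 1); rewrite /q; lra.
(* The bound on [b] concerns only the end [y]; it spreads to the whole interval because [K] is
   constant while [Phi_lb] increases. *)
have qU t : x <= t <= y -> (q t)^-1 <= excess_ub (t + 1).
  move=> /andP[xt ty]; have t1 : 0 < t + 1 by lra.
  rewrite -[excess_ub _]invrK -[(excess_ub _)^-1]div1r excess_ubE//.
  rewrite lef_pV2 ?posrE//; last first.
    by have := Phi_lb_gt0 t1; have := sqr_ge0 (t + 1); lra.
  have : Phi_lb (t + 1) <= Phi_lb (y + 1) by apply: Phi_lb_le; lra.
  rewrite /q; lra.
have h0 t : 0 < t -> 0 < h t by move=> t0; rewrite addr_gt0 ?invr_gt0 ?gap_gt0.
have fxy : f x < f y.
  apply: (derive_gt0_lt (df := fun t => - (h t) ^- 2 *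
    (- (q t) ^- 2 * (48 * (t + 1)) - 1 / (t * (t + 1) * (2 * t + 1) ^+ 2)) - 48 * t) xy).
    move=> t /andP[xt ty]; have t0 : 0 < t by lra.
    have dq : is_derive t 1 q (48 * (t + 1)).
      by apply: is_derive_eq; rewrite /GRing.scale /=; ring.
    have dqV := @is_deriveV _ q t _ 1 (lt0r_neq0 (q0 t)) dq.
    have dg := is_derive_gap t0.
    have dh : is_derive t 1 h
      (- (q t) ^- 2 * (48 * (t + 1)) - 1 / (t * (t + 1) * (2 * t + 1) ^+ 2)).
      exact: is_deriveD.
    have dhV := @is_deriveV _ h t _ 1 (lt0r_neq0 (h0 t t0)) dh.
    by apply: is_derive_eq; rewrite /GRing.scale /=; ring.
  move=> t /andP[xt ty]; have t0 : 0 < t by lra.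
  have tI : x <= t <= y by rewrite !ltW.
  have qV0 : 0 < (q t)^-1 by rewrite invr_gt0.
  have := gap_step_lt t0 qV0 (qU t tI); rewrite -/(h t).
  rewrite -exprVn; set r := 1 / _; set s := (q t)^-1 => H.
  rewrite -exprVn subr_gt0 -(@ltr_pM2r _ (h t ^+ 2)) ?exprn_gt0 ?h0//.
  have -> : - (h t)^-1 ^+ 2 * (- s ^+ 2 * (48 * (t + 1)) - r) * h t ^+ 2 =
      48 * (t + 1) * s ^+ 2 + r.
    by field; rewrite lt0r_neq0 ?h0.
  exact: H.
have qy : (q y)^-1 = b by rewrite /q /K addrC subrK div1r invrK.
have qx : (q x)^-1 <= a.
  rewrite -[a]invrK lef_pV2 ?posrE ?invr_gt0// -div1r /q /K; lra.
have : 1 / (a + gap x) <= (h x)^-1.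
  rewrite div1r lef_pV2 ?posrE ?h0// ?lerD2r// addr_gt0 ?gap_gt0//.
move: fxy; rewrite /f {2}/h qy -div1r; lra.
Qed.

(** * The function psi(x + 1/2) - ln x as a limit *)

(* Locked so that conversion never unfolds the integral in [digamma]. *)
Fact excess_key : unit. Proof. exact: tt. Qed.

Definition excess (R : realType) : R -> R :=
  locked_with excess_key (fun x => digamma (x + 1 / 2) - ln x).

Lemma excessE (R : realType) (x : R) : excess x = digamma (x + 1 / 2) - ln x.
Proof. by rewrite /excess unlock. Qed.

Lemma PhiE (R : realType) (x : R) : Phi x = 1 / excess x - 24 * x ^+ 2.
Proof. by rewrite excessE. Qed.

Lemma excessS (R : realType) (x : R) : 0 < x -> excess x = excess (x + 1) + gap x.
Proof.
move=> x0; have z0 : 0 < x + 1 / 2 by lra.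
rewrite !excessE /gap -[x + 1 + _]addrAC digammaS// div1r; lra.
Qed.

Lemma normr_excess_le (R : realType) (x : R) : 0 < x -> `|excess x| <= x^-1.
Proof.
move=> x0; have z0 : 0 < x + 1 / 2 by lra.
have xV0 : 0 < x^-1 by rewrite invr_gt0.
have := digamma_le_ln z0; have := ln_le_digammaS z0; rewrite digammaS//.
have zx : (x + 1 / 2)^-1 <= x^-1 by rewrite lef_pV2 ?posrE//; lra.
have lnxz : ln x <= ln (x + 1 / 2) by rewrite ler_ln ?posrE//; lra.
have lnzx : ln (x + 1 / 2) <= ln x + x^-1.
  have -> : x + 1 / 2 = x * (1 + x^-1 / 2) by field; rewrite gt_eqF.
  rewrite lnM ?posrE//; last by lra.
  have := @le_ln1Dx R (x^-1 / 2) ltac:(lra); lra.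
rewrite ler_norml excessE => h1 h2; apply/andP; split; lra.
Qed.

Fixpoint excess_approx (R : realType) (n : nat) (x : R) : R :=
  if n is m.+1 then excess_approx m (x + 1) + gap x else excess_ub x.

(** Both functions satisfy the same recurrence, so the gaps cancel and the error is the initial one
    moved out to [x + n], where both terms are small. *)
Lemma excess_approxB (R : realType) (n : nat) (x : R) : 0 < x ->
  excess_approx n x - excess x = excess_ub (x + n%:R) - excess (x + n%:R).
Proof.
elim: n x => [|n IH] x x0 /=; first by rewrite addr0.
have x10 : 0 < x + 1 by rewrite addr_gt0.
by rewrite excessS// opprD addrACA subrr addr0 IH// -addrA -natr1 [n%:R + 1]addrC.
Qed.

(** Induction with [excess_lb] as subsolution and [excess_ub] as supersolution of the recurrence. *)
Lemma excess_approx_bounds (R : realType) (n : nat) (x : R) : 0 < x ->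
  excess_lb x <= excess_approx n x <= excess_ub x.
Proof.
elim: n x => [|n IH] x x0 /=.
  rewrite lexx andbT -[excess_ub x]invrK -[(excess_ub x)^-1]div1r excess_ubE//.
  rewrite /excess_lb div1r.
  have x2 : 0 < x ^+ 2 by rewrite exprn_gt0.
  have cx := Phi_lb_gt0 x0.
  rewrite lef_pV2 ?posrE; [|lra|lra].
  by rewrite lerD2l /Phi_lb ler_pdivrMr; lra.
have x10 : 0 < x + 1 by rewrite addr_gt0.
have /andP[lo up] := IH _ x10.
have := excess_lb_sub_le_gap x0; have := gap_lt_ub x0; have := gap_ub_le_excess_ub_sub x0.
by move=> h1 h2 h3; apply/andP; split; lra.
Qed.

Lemma excess_lb_gt0 (R : realType) (x : R) : 0 < excess_lb x.
Proof. by rewrite divr_gt0//; have := sqr_ge0 x; lra. Qed.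

Lemma excess_approx_gt0 (R : realType) (n : nat) (x : R) : 0 < x ->
  0 < excess_approx n x.
Proof.
move=> x0; have /andP[+ _] := excess_approx_bounds n x0.
exact: lt_le_trans (excess_lb_gt0 x).
Qed.

Lemma excess_approx_incr (R : realType) (n : nat) (x y : R) : 0 < x -> x < y ->
  24 * (y ^+ 2 - x ^+ 2) <= 1 / excess_approx n y - 1 / excess_approx n x.
Proof.
elim: n x y => [|n IH] x y x0 xy /=; have y0 : 0 < y by lra.
  rewrite !excess_ubE//; have := Phi_lb_le x0 (ltW xy); lra.
have x10 : 0 < x + 1 by lra.
have y10 : 0 < y + 1 by lra.
apply/ltW/gap_step => //; rewrite ?excess_approx_gt0//.
- by have /andP[] := excess_approx_bounds n y10.
- by apply: IH => //; lra.
Qed.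

Lemma excess_ub_le_inv (R : realType) (x : R) : 1 <= x -> excess_ub x <= x^-1.
Proof.
move=> x1; have x0 : 0 < x by lra.
rewrite -[excess_ub x]invrK -[(excess_ub x)^-1]div1r excess_ubE//.
have := Phi_lb_gt0 x0; have x2 : x <= x ^+ 2 by rewrite expr2 ler_peMl// ltW.
by move=> cx; rewrite lef_pV2 ?posrE; lra.
Qed.

Lemma cvg_excess_approx (R : realType) (x : R) : 0 < x ->
  excess_approx n.+1 x @[n --> \oo] --> excess x.
Proof.
move=> x0; have ch c : excess x + c * harmonic n @[n --> \oo] --> excess x.
  rewrite -[X in _ --> X]addr0 -[X in _ --> _ + X](mulr0 c).
  by apply: cvgD; [exact: cvg_cst|apply: cvgMl_tmp; exact: cvg_harmonic].
(* At [x + n + 1], which exceeds 1, [excess_ub] and [|excess|] are each at most [1/(n + 1)], hence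
   the factor 2. *)
apply: (squeeze_cvgr _ (ch (- 2)) (ch 2)); apply: nearW => n.
have xn : n.+1%:R < x + n.+1%:R by rewrite ltrDr.
have n1 : 1 <= n.+1%:R :> R by rewrite ler1n.
have xn0 : 0 < x + n.+1%:R by lra.
have h0 : 0 < excess_ub (x + n.+1%:R) by exact: excess_ub_gt0.
have h1 : excess_ub (x + n.+1%:R) <= (x + n.+1%:R)^-1 by apply: excess_ub_le_inv; lra.
have := normr_excess_le xn0; rewrite ler_norml => /andP[h2 h3].
have h4 : (x + n.+1%:R)^-1 <= harmonic n by rewrite lef_pV2 ?posrE// ltW.
have := excess_approxB n.+1 x0 => h5.
by apply/andP; split; lra.
Qed.

Lemma excess_bounds (R : realType) (x : R) : 0 < x -> excess_lb x <= excess x <= excess_ub x.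
Proof.
move=> x0; have ce := cvg_excess_approx x0; apply/andP; split.
  apply: (cvgr_to_ge ce); apply: nearW => n.
  by have /andP[] := excess_approx_bounds n.+1 x0.
apply: (cvgr_to_le ce); apply: nearW => n.
by have /andP[] := excess_approx_bounds n.+1 x0.
Qed.

Lemma excess_gt0 (R : realType) (x : R) : 0 < x -> 0 < excess x.
Proof.
move=> x0; have /andP[+ _] := excess_bounds x0.
exact: lt_le_trans (excess_lb_gt0 x).
Qed.

Lemma inv_excess_incr_le (R : realType) (x y : R) : 0 < x -> x < y ->
  24 * (y ^+ 2 - x ^+ 2) <= 1 / excess y - 1 / excess x.
Proof.
move=> x0 xy; have y0 : 0 < y by lra.
have cV (z : R) : 0 < z -> 1 / excess_approx n.+1 z @[n --> \oo] --> 1 / excess z.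
  move=> z0; under eq_fun do rewrite div1r.
  by rewrite div1r; apply: cvgV; [rewrite gt_eqF// excess_gt0|exact: cvg_excess_approx].
have cB : 1 / excess_approx n.+1 y - 1 / excess_approx n.+1 x @[n --> \oo] -->
    1 / excess y - 1 / excess x by apply: cvgB; exact: cV.
by apply: (cvgr_to_ge cB); apply: nearW => n; exact: excess_approx_incr.
Qed.

(** Passing to the limit loses strictness; one more iteration step, from [x + 1] and [y + 1] back to
    [x] and [y], restores it. *)
Lemma Phi_incr (R : realType) (x y : R) : 0 < x -> x < y -> Phi x < Phi y.
Proof.
move=> x0 xy; have y0 : 0 < y by lra.
have x10 : 0 < x + 1 by lra.
have y10 : 0 < y + 1 by lra.
have xy1 : x + 1 < y + 1 by lra.
have /andP[_ yU] := excess_bounds y10.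
have := gap_step x0 xy (excess_gt0 x10) (excess_gt0 y10) yU (inv_excess_incr_le x10 xy1).
rewrite -(excessS x0) -(excessS y0) !PhiE.
lra.
Qed.

(** * Monotonicity of psi and continuity of [Phi] *)

Lemma digamma_nondecreasing (R : realType) (x y : R) : 0 < x -> x <= y ->
  digamma x <= digamma y.
Proof.
move=> x0 xy.
(* Each unit shift adds [1/(y + n) - 1/(x + n) <= 0] to the difference, while the logarithmic bounds
   keep the shifted difference above a quantity tending to 0. *)
have step n : digamma (y + n%:R) - digamma (x + n%:R) <= digamma y - digamma x.
  elim: n => [|n IH]; first by rewrite !addr0.
  have xn0 : 0 < x + n%:R by rewrite ltr_wpDr.
  have yn0 : 0 < y + n%:R by rewrite ltr_wpDr// (lt_le_trans x0).
  have : (y + n%:R)^-1 <= (x + n%:R)^-1 by rewrite lef_pV2 ?posrE// lerD2r.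
  have := digammaS xn0; have := digammaS yn0; rewrite -!addrA natr1.
  move: IH; move: (digamma _) (digamma _) (digamma _) (digamma _) => a b c d.
  move: (_^-1) (_^-1) (digamma _) (digamma _) => e f g h; lra.
rewrite -subr_ge0.
have c0 : - harmonic n @[n --> \oo] --> (0 : R).
  by rewrite -oppr0; apply: cvgN; exact: cvg_harmonic.
apply: (cvgr_to_le c0); apply: nearW => n.
apply: le_trans (step n.+1).
have n0 : 0 < n.+1%:R :> R by [].
have xn0 : 0 < x + n.+1%:R by rewrite addr_gt0.
have xyn : x + n.+1%:R <= y + n.+1%:R by rewrite lerD2r.
have yn0 : 0 < y + n.+1%:R by lra.
have h3 : ln (x + n.+1%:R) <= ln (y + n.+1%:R) by rewrite ler_ln ?posrE.
have h4 : (y + n.+1%:R)^-1 <= harmonic n by rewrite lef_pV2 ?posrE//; lra.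
have := digamma_le_ln xn0; have := ln_le_digammaS yn0; rewrite digammaS//.
move: (digamma _) (digamma _) => a b h1 h2; lra.
Qed.

(** [excess] decreases, and adding [ln] to it gives the nondecreasing [psi(x + 1/2)], so it falls by
    at most the rise of [ln]. Continuity follows without a second derivative of Gamma. *)
Lemma excess_dist_le (R : realType) (x y : R) : 0 < x -> x < y ->
  `|excess x - excess y| <= `|ln x - ln y|.
Proof.
move=> x0 xy; have y0 : 0 < y by lra.
have lnxy : ln x <= ln y by rewrite ler_ln ?posrE// ltW.
have ex := excess_gt0 x0; have ey := excess_gt0 y0.
have xy2 : x ^+ 2 < y ^+ 2 by rewrite ltr_sqr ?nnegrE; lra.
have := inv_excess_incr_le x0 xy; rewrite !div1r => h.
have eyx : excess y < excess x.
  rewrite -[ltLHS]invrK -[ltRHS]invrK ltf_pV2 ?posrE ?invr_gt0//; lra.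
rewrite ger0_norm ?subr_ge0 ?(ltW eyx)// ler0_norm ?subr_le0//.
have : digamma (x + 1 / 2) <= digamma (y + 1 / 2).
  by apply: digamma_nondecreasing; lra.
rewrite !excessE; move: (digamma _) (digamma _) => a b; lra.
Qed.

Lemma continuous_excess (R : realType) (x : R) : 0 < x ->
  {for x, continuous (@excess R)}.
Proof.
move=> x0; apply/cvgrPdist_lt => e e0.
have /cvgrPdist_lt/(_ e e0) := continuous_ln x0.
apply: filterS2 (lt_nbhsr x0) => y y0; apply: le_lt_trans.
have [xy|yx|->] := ltgtP x y; last by rewrite !subrr.
- exact: excess_dist_le.
- by rewrite distrC (distrC (ln x)); exact: excess_dist_le.
Qed.

Lemma continuous_Phi (R : realType) (x : R) : 0 < x -> {for x, continuous (@Phi R)}.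
Proof.
move=> x0.
have -> : @Phi R = fun t => (excess t)^-1 - 24 * t ^+ 2.
  by apply/funext => t; rewrite PhiE div1r.
apply: cvgB.
  by apply: cvgV; [rewrite gt_eqF// excess_gt0|exact: continuous_excess].
by apply: cvgMl_tmp; exact: exprn_continuous.
Qed.

(** * The range of [Phi] *)

Lemma Phi_lb_le_Phi (R : realType) (x : R) : 0 < x -> Phi_lb x <= Phi x.
Proof.
move=> x0; have /andP[_ eU] := excess_bounds x0.
have : 1 / excess_ub x <= 1 / excess x.
  by rewrite !div1r lef_pV2 ?posrE ?excess_ub_gt0 ?excess_gt0.
rewrite excess_ubE// PhiE; lra.
Qed.

Lemma Phi_le (R : realType) (x : R) : 0 < x -> Phi x <= 21 / 5.
Proof.
move=> x0; have /andP[eL _] := excess_bounds x0.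
have : 1 / excess x <= 1 / excess_lb x.
  by rewrite !div1r lef_pV2 ?posrE ?excess_lb_gt0 ?excess_gt0.
rewrite /excess_lb [1 / (1 / _)]div1r [1 / (24 * _ + _)]div1r invrK PhiE; lra.
Qed.

Lemma Phi_le_exists (R : realType) (v : R) : 0 < v -> exists2 x : R, 0 < x & Phi x <= v.
Proof.
move=> v0; have vV0 : 0 < v^-1 by rewrite invr_gt0.
(* Here [- ln x = 2 + 1/v], and the 2 absorbs [1/(x + 1/2) <= 2] in [gap x], so
   [excess x >= gap x >= 1/v]. *)
exists (expR (- (2 + v^-1))); first exact: expR_gt0.
set x := expR _; have x0 : 0 < x by exact: expR_gt0.
have x10 : 0 < x + 1 by lra.
have ge : gap x <= excess x by rewrite excessS// lerDr ltW// excess_gt0.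
have h1 : 1 / (x + 1 / 2) <= 2 by rewrite ler_pdivrMr; lra.
have h2 : 0 <= ln (x + 1) by rewrite ln_ge0//; lra.
have h3 : v^-1 <= excess x by apply: le_trans ge; rewrite /gap {2}/x expRK; lra.
have : 1 / excess x <= v by rewrite div1r -[leRHS]invrK lef_pV2 ?posrE ?excess_gt0.
have := sqr_ge0 x; rewrite PhiE; lra.
Qed.

Lemma Phi_ge_exists (R : realType) (v : R) : 0 < v -> v < 21 / 5 ->
  exists2 x : R, 0 < x & v <= Phi x.
Proof.
move=> v0 v1; have d0 : 0 < 21 - 5 * v by lra.
(* [v <= Phi_lb x] amounts to [w <= x^2], which [x = w + 1] satisfies since
   [(w + 1)^2 - w = w^2 + w + 1]. *)
pose w := 2 * v / (21 - 5 * v).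
have w0 : 0 < w by rewrite divr_gt0//; lra.
exists (w + 1); first by lra.
have x0 : 0 < w + 1 by lra.
apply: le_trans (Phi_lb_le_Phi x0); rewrite /Phi_lb ler_pdivlMr; last first.
  by have := sqr_ge0 (w + 1); lra.
have wE : w * (21 - 5 * v) = 2 * v by rewrite divfK// gt_eqF.
have : 0 <= (w ^+ 2 + w + 1) * (21 - 5 * v).
  by rewrite mulr_ge0 ?ltW//; have := sqr_ge0 w; lra.
lra.
Qed.

Theorem proposition1 (R : realType) :
  {in `]0, +oo[ &, {homo @Phi R : x y / x < y}} /\
  @Phi R @` `]0, +oo[%classic = `]0, 21 / 5[%classic.
Proof.
split.
  by move=> x y; rewrite !in_itv/= !andbT => x0 _; exact: Phi_incr.
apply/seteqP; split => v /=.
  move=> [x]; rewrite !in_itv/= andbT => x0 <-.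
  rewrite (lt_le_trans (Phi_lb_gt0 x0) (Phi_lb_le_Phi x0))/=.
  (* The value [21/5] is not attained, as [Phi x < Phi (x + 1) <= 21/5]. *)
  have x1 : x < x + 1 by lra.
  by apply: lt_le_trans (Phi_incr x0 x1) (Phi_le _); lra.
rewrite in_itv/= => /andP[v0 v1].
have [x x0 xv] := Phi_le_exists v0.
have [y y0 vy] := Phi_ge_exists v0 v1.
(* If [y < x], strict monotonicity would give [v <= Phi y < Phi x <= v]. *)
have xy : x <= y.
  rewrite leNgt; apply/negP => /(Phi_incr y0); lra.
have cf : {within `[x, y], continuous (@Phi R)}.
  apply: continuous_in_subspaceT => t /[!inE]/=; rewrite in_itv/= => /andP[xt _].
  by apply: continuous_Phi; lra.
have [|c] := @IVT _ _ _ _ v xy cf.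
  by rewrite ge_min xv le_max vy orbT.
rewrite in_itv/= => /andP[xc _] <-; exists c => //.
by rewrite /= in_itv/= andbT; lra.
Qed.
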